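(* Let $X$ be a subspace of a Hausdorff topological group $H$. If $X$ is a Lindelöf $\Sigma$-space and $X$ generates a dense subgroup of $H$, then $w(X)\leq w(H)\leq 2^{\psi(X)}$.
   Context: $w$ weight, $\psi$ pseudocharacter (infinite values). The Nagami number $Nag(Y)$ of a Tychonoff space $Y$ is the minimal cardinality of a family $\mathcal F$ of closed subsets of $\beta Y$ such that for every $y\in Y$ and $z\in\beta Y\setminus Y$ there is $F\in\mathcal F$ with $y\in F$, $z\notin F$; $Y$ is a Lindelöf $\Sigma$-space if $Nag(Y)\leq\omega$. *)

(* Defs.v *)
From Stdlib Require Import List.

Definition is_topology {T : Type} (op : (T -> Prop) -> Prop) : Prop :=
  op (fun _ => True) /\
  (forall U V, op U -> op V -> op (fun x => U x /\ V x)) /\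
  (forall F : (T -> Prop) -> Prop, (forall U, F U -> op U) ->
     op (fun x => exists U, F U /\ U x)).

Definition closed {T : Type} (op : (T -> Prop) -> Prop) (C : T -> Prop) : Prop :=
  op (fun x => ~ C x).

Definition hausdorff {T : Type} (op : (T -> Prop) -> Prop) : Prop :=
  forall x y : T, x <> y ->
    exists U V, op U /\ op V /\ U x /\ V y /\ forall z, ~ (U z /\ V z).

Definition compact {T : Type} (op : (T -> Prop) -> Prop) : Prop :=
  forall (I : Type) (U : I -> T -> Prop), (forall i, op (U i)) ->
    (forall x, exists i, U i x) ->
    exists l : list I, forall x, exists i, In i l /\ U i x.

Definition continuous {A B : Type} (opA : (A -> Prop) -> Prop)
  (opB : (B -> Prop) -> Prop) (f : A -> B) : Prop :=
  forall V, opB V -> opA (fun x => V (f x)).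

Definition dense {T : Type} (op : (T -> Prop) -> Prop) (D : T -> Prop) : Prop :=
  forall U, op U -> (exists x, U x) -> exists x, U x /\ D x.

Definition subspace {T : Type} (op : (T -> Prop) -> Prop) (X : T -> Prop)
  : ({x | X x} -> Prop) -> Prop :=
  fun U => exists V, op V /\ forall x : {x | X x}, U x <-> V (proj1_sig x).

Definition embedding {A B : Type} (opA : (A -> Prop) -> Prop)
  (opB : (B -> Prop) -> Prop) (e : A -> B) : Prop :=
  (forall a a', e a = e a' -> a = a') /\ continuous opA opB e /\
  (forall U, opA U -> exists V, opB V /\ forall a, U a <-> V (e a)).

Definition stone_cech {Y K : Type} (opY : (Y -> Prop) -> Prop)
  (opK : (K -> Prop) -> Prop) (e : Y -> K) : Prop :=
  is_topology opK /\ compact opK /\ hausdorff opK /\ embedding opY opK e /\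
  dense opK (fun z => exists y, e y = z) /\
  (forall (Z : Type) (opZ : (Z -> Prop) -> Prop) (f : Y -> Z),
     is_topology opZ -> compact opZ -> hausdorff opZ -> continuous opY opZ f ->
     exists g : K -> Z, continuous opK opZ g /\ forall y, g (e y) = f y).

(* Lindelof Sigma-space: Nag(Y) <= omega, i.e. there is a countable family of
   closed subsets of beta Y separating points of Y from points of beta Y \ Y. *)
Definition lindelof_sigma {Y : Type} (opY : (Y -> Prop) -> Prop) : Prop :=
  exists (K : Type) (opK : (K -> Prop) -> Prop) (e : Y -> K),
    stone_cech opY opK e /\
    exists F : nat -> K -> Prop,
      (forall n, closed opK (F n)) /\
      forall (y : Y) (z : K), (forall y', e y' <> z) ->
        exists n, F n (e y) /\ ~ F n z.

Definition weight_le {T : Type} (op : (T -> Prop) -> Prop) (J : Type) : Prop :=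
  exists (S : J -> Prop) (B : J -> T -> Prop),
    (forall j, S j -> op (B j)) /\
    forall U x, op U -> U x -> exists j, S j /\ B j x /\ forall y, B j y -> U y.

Definition psi_le {T : Type} (op : (T -> Prop) -> Prop) (J : Type) : Prop :=
  forall x : T, exists (S : J -> Prop) (P : J -> T -> Prop),
    (forall j, S j -> op (P j) /\ P j x) /\
    forall y, (forall j, S j -> P j y) -> y = x.

Definition card_le (A B : Type) : Prop := exists f : A -> B, forall a a', f a = f a' -> a = a'.

Definition is_topgroup {G : Type} (op : (G -> Prop) -> Prop)
  (mul : G -> G -> G) (inv : G -> G) (e : G) : Prop :=
  is_topology op /\
  (forall x y z, mul x (mul y z) = mul (mul x y) z) /\
  (forall x, mul e x = x) /\ (forall x, mul (inv x) x = e) /\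
  (forall W x y, op W -> W (mul x y) ->
     exists U V, op U /\ op V /\ U x /\ V y /\
       forall u v, U u -> V v -> W (mul u v)) /\
  continuous op op inv.

Definition gen_subgroup {G : Type} (mul : G -> G -> G) (inv : G -> G) (e : G)
  (X : G -> Prop) (h : G) : Prop :=
  forall S : G -> Prop,
    S e -> (forall a b, S a -> S b -> S (mul a b)) -> (forall a, S a -> S (inv a)) ->
    (forall x, X x -> S x) -> S h.

(* Main.v *)
(* Let J be infinite with psi(X) <= J.  Around each point y of X the closed sets
   witnessing the Sigma-property cut out of the Stone-Cech compactification a compact
   set C_y contained in X.  There are at most 2^omega sets C_y, and each has at most 2^J
   points by Arhangel'skii's theorem, so |X| <= 2^J and the generated subgroup Y has at
   most 2^J points.

   Moreover Y again has a small network modulo a cover by compact sets.  Such a set Y,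
   dense in a regular space, bounds its weight: any pair Z included in O (Z closed,
   O open) is separated on each of the compact sets by a finite union of finite
   intersections of open sets chosen once for each pair of points of Y, hence also
   on some network element.  Gluing these over the network gives at most
   (2^J)^J = 2^J sets between Z and O, and the interiors of their closures form a base. *)

From Stdlib Require Import List Arith Lia Cantor.
From Stdlib Require Import Classical ClassicalEpsilon FunctionalExtensionality PropExtensionality.
From mathcomp Require classical_sets.
Require Import Defs.
Import ListNotations.
Set Bullet Behavior "Strict Subproofs".

(** * Extensionality, choice and Zorn's lemma for predicates *)

Lemma pred_ext {T : Type} (A B : T -> Prop) : (forall x, A x <-> B x) -> A = B.
Proof.
  intros H. apply functional_extensionality. intros x. apply propositional_extensionality, H.
Qed.

Lemma choice_fun {A B : Type} (R : A -> B -> Prop) :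
  (forall a, exists b, R a b) -> exists f, forall a, R a (f a).
Proof.
  intros H. exists (fun a => proj1_sig (constructive_indefinite_description _ (H a))).
  intros a. apply proj2_sig.
Qed.

Lemma choice_on {A B : Type} (b0 : B) (P : A -> Prop) (R : A -> B -> Prop) :
  (forall a, P a -> exists b, R a b) -> exists f, forall a, P a -> R a (f a).
Proof.
  intros H. apply (choice_fun (fun a b => P a -> R a b)). intros a.
  destruct (classic (P a)) as [h|h].
  - destruct (H a h) as [b hb]. now exists b.
  - now exists b0.
Qed.

(** Zorn's lemma is applied to the sets [R] for which [R] together with [R0] satisfies [P], which
    forces the maximal set above [R0]. The empty chain then has union [R0], so the chain hypothesis
    is only called on nonempty families. *)
Lemma zorn_above {T : Type} (P : (T -> Prop) -> Prop) (R0 : T -> Prop) :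
  P R0 ->
  (forall F : (T -> Prop) -> Prop,
     (exists R, F R) ->
     (forall R, F R -> P R) ->
     (forall R R', F R -> F R' -> (forall t, R t -> R' t) \/ (forall t, R' t -> R t)) ->
     P (fun t => exists R, F R /\ R t)) ->
  exists M, P M /\ (forall t, R0 t -> M t) /\
    forall R, P R -> (forall t, M t -> R t) -> forall t, R t -> M t.
Proof.
  intros P0 Hchain.
  destruct (@classical_sets.Zorn_bigcup T (fun R : T -> Prop => P (fun t => R t \/ R0 t))) as [A [PA mA]].
  - intros F FP Ftot. destruct (classic (exists R, F R)) as [[R1 FR1]|hF].
    + assert (E : (fun t => classical_sets.bigcup F (fun X => X) t \/ R0 t) =
        (fun t => exists R, (fun R => exists R', F R' /\ R = fun t => R' t \/ R0 t) R /\ R t)).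
      { apply pred_ext. intros t. split.
        - intros [[R FR Rt]|h].
          + exists (fun t => R t \/ R0 t). split; eauto.
          + exists (fun t => R1 t \/ R0 t). split; eauto.
        - intros [R [[R' [FR' ->]] [h|h]]]; [left; exists R'|right]; assumption. }
      rewrite E. apply Hchain.
      * exists (fun t => R1 t \/ R0 t); eauto.
      * intros R [R' [FR' ->]]. apply FP, FR'.
      * intros R R' [Q [FQ ->]] [Q' [FQ' ->]].
        destruct (Ftot Q Q' FQ FQ') as [h|h]; [left|right]; intros t [a|a]; auto.
    + assert (E : (fun t => classical_sets.bigcup F (fun X => X) t \/ R0 t) = R0).
      { apply pred_ext. intros t. split; auto. intros [[R FR _]|h]; auto.
        exfalso; eauto. }
      rewrite E. exact P0.
  - exists (fun t => A t \/ R0 t). split; [exact PA|]. split; [auto|].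
    intros R PR AR t Rt. apply NNPP. intros nA.
    apply (mA R).
    + split; [intros x Ax; apply AR; auto|].
      intros sub. apply nA. left. now apply sub.
    + replace (fun t => R t \/ R0 t) with R; [exact PR|].
      apply pred_ext. intros x. split; auto. intros [h|h]; auto.
Qed.

(** * Comparability of cardinals *)

Lemma card_le_refl (A : Type) : card_le A A.
Proof. exists (fun a => a). auto. Qed.

Lemma card_le_trans (A B C : Type) : card_le A B -> card_le B C -> card_le A C.
Proof. intros [f hf] [g hg]. exists (fun a => g (f a)). auto. Qed.

(** A maximal partial injection is total or onto: otherwise two unmatched points could be paired and
    added to it. *)
Lemma card_le_total (A B : Type) : card_le A B \/ card_le B A.
Proof.
  destruct (zorn_above (fun R : A * B -> Prop =>
    (forall a b b', R (a, b) -> R (a, b') -> b = b') /\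
    (forall a a' b, R (a, b) -> R (a', b) -> a = a')) (fun _ => False)) as [M [[Mf Mi] [_ Mmax]]].
  - tauto.
  - intros F _ FP Ftot. split.
    + intros a b b' [R [FR h]] [R' [FR' h']].
      destruct (Ftot R R' FR FR') as [i|i]; [apply (FP R') in FR'|apply (FP R) in FR]; firstorder.
    + intros a a' b [R [FR h]] [R' [FR' h']].
      destruct (Ftot R R' FR FR') as [i|i]; [apply (FP R') in FR'|apply (FP R) in FR]; firstorder.
  - destruct (classic (forall a, exists b, M (a, b))) as [h|h].
    + left. destruct (choice_fun _ h) as [f hf]. exists f. intros a a' E.
      apply (Mi a a' (f a)); [|rewrite E]; apply hf.
    + apply not_all_ex_not in h. destruct h as [a0 ha]. right.
      assert (h : forall b, exists a, M (a, b)).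
      { intros b. apply NNPP. intros hb. apply ha. exists b.
        apply (Mmax (fun t => M t \/ t = (a0, b))); auto. split.
        - intros a b1 b2 [h1|h1] [h2|h2]; try congruence; eauto; exfalso; apply ha;
            [injection h2|injection h1]; intros; subst; eauto.
        - intros a1 a2 b1 [h1|h1] [h2|h2]; try congruence; eauto; exfalso; apply hb;
            [injection h2|injection h1]; intros; subst; eauto. }
      destruct (choice_fun _ h) as [f hf]. exists f. intros b b' E.
      apply (Mf (f b)); [|rewrite E]; apply hf.
Qed.

(** * The square of an infinite cardinal *)

Definition fld {J : Type} (R : (J * J) * J -> Prop) (x : J) : Prop :=
  exists a b z, R ((a, b), z) /\ (a = x \/ b = x \/ z = x).

(* Zorn's lemma is applied to graphs of injections [D * D -> D]; the set [D] is
   recovered as the field of the graph. *)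
Definition square_graph {J : Type} (R : (J * J) * J -> Prop) : Prop :=
  (forall p z z', R (p, z) -> R (p, z') -> z = z') /\
  (forall p p' z, R (p, z) -> R (p', z) -> p = p') /\
  (forall x y, fld R x -> fld R y -> exists z, R ((x, y), z)).

(** Cantor's pairing is carried over to the range of [c]; this is the graph from which the Zorn
    argument starts. *)
Lemma square_graph_nat {J : Type} (c : nat -> J) :
  (forall m n, c m = c n -> m = n) ->
  square_graph (fun t => exists m n, t = ((c m, c n), c (to_nat (m, n)))).
Proof.
  intros ci. split; [|split].
  - intros p z z' [m [n E]] [m' [n' E']]. injection E as -> ->. injection E' as h1 h2 ->.
    apply ci in h1, h2. now subst.
  - intros p p' z [m [n E]] [m' [n' E']]. injection E as -> ->. injection E' as -> h.
    apply ci in h. change (to_nat (m, n) = to_nat (m', n')) in h.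
    apply (f_equal of_nat) in h. rewrite !cancel_of_to in h.
    now injection h as -> ->.
  - assert (H : forall x, fld (fun t => exists m n, t = ((c m, c n), c (to_nat (m, n)))) x ->
      exists k, x = c k).
    { intros x [a [b [z [[m [n E]] h]]]]. inversion E; subst.
      destruct h as [<-|[<-|<-]]; eauto. }
    intros x y hx hy. destruct (H x hx) as [m ->]. destruct (H y hy) as [n ->].
    exists (c (to_nat (m, n))), m, n. reflexivity.
Qed.

(** Any two triples of the union already lie in one member of the chain, so each clause is inherited
    from that member. *)
Lemma square_graph_chain {J : Type} (F : ((J * J) * J -> Prop) -> Prop) :
  (forall R, F R -> square_graph R) ->
  (forall R R', F R -> F R' -> (forall t, R t -> R' t) \/ (forall t, R' t -> R t)) ->
  square_graph (fun t => exists R, F R /\ R t).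
Proof.
  intros FP Ftot.
  assert (D : forall t t', (exists R, F R /\ R t) -> (exists R, F R /\ R t') ->
    exists R, F R /\ R t /\ R t').
  { intros t t' [R [FR h]] [R' [FR' h']].
    destruct (Ftot R R' FR FR') as [i|i]; [exists R'|exists R]; auto. }
  split; [|split].
  - intros p z z' h h'. destruct (D _ _ h h') as [R [FR [a b]]].
    apply (proj1 (FP R FR) p); assumption.
  - intros p p' z h h'. destruct (D _ _ h h') as [R [FR [a b]]].
    apply (proj1 (proj2 (FP R FR)) p p' z); assumption.
  - intros x y [a [b [z [h hx]]]] [a' [b' [z' [h' hy]]]].
    destruct (D _ _ h h') as [R [FR [i j]]].
    destruct (proj2 (proj2 (FP R FR)) x y) as [w hw].
    + exists a, b, z; auto.
    + exists a', b', z'; auto.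
    + exists w, R; auto.
Qed.

(* The new pairs are sent injectively into the disjoint copy [j D] of [D],
   tagged by which of their two entries lie in that copy. *)
Lemma square_graph_extend {J : Type} (R : (J * J) * J -> Prop) (j : J -> J)
  (t1 t2 t3 : J) :
  square_graph R ->
  (forall x, fld R x -> ~ fld R (j x)) ->
  (forall x y, fld R x -> fld R y -> j x = j y -> x = y) ->
  fld R t1 -> fld R t2 -> fld R t3 -> t1 <> t2 -> t1 <> t3 -> t2 <> t3 ->
  exists R', square_graph R' /\ (forall p, R p -> R' p) /\ exists p, R' p /\ ~ R p.
Proof.
  intros [Rf [Ri Rt]] jn ji h1 h2 h3 n12 n13 n23.
  destruct (choice_on (A := J * J) t1 (fun p => fld R (fst p) /\ fld R (snd p))
    (fun p z => R (p, z))) as [f hf].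
  { intros [x y] [hx hy]. apply Rt; assumption. }
  assert (fA : forall x y, fld R x -> fld R y -> fld R (f (x, y))).
  { intros x y hx hy. exists x, y, (f (x, y)). split; [apply hf; cbn; auto|auto]. }
  assert (fi : forall x y x' y', fld R x -> fld R y -> fld R x' -> fld R y' ->
    f (x, y) = f (x', y') -> x = x' /\ y = y').
  { intros x y x' y' hx hy hx' hy' E.
    assert (E' : (x, y) = (x', y')).
    { apply (Ri _ _ (f (x, y))); [|rewrite E]; apply hf; auto. }
    now injection E'. }
  assert (RA : forall a b z, R ((a, b), z) -> fld R a /\ fld R b /\ fld R z).
  { intros a b z h. repeat split; exists a, b, z; auto. }
  (* The arguments [t], [a], [b] can be read back from the code because [f] and [j] are injective;
     the tag [t] keeps the three kinds of new pairs apart. *)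
  set (code := fun t a b => j (f (t, f (a, b)))).
  assert (codeA : forall t a b, fld R t -> fld R a -> fld R b -> ~ fld R (code t a b)).
  { intros. apply jn. auto. }
  assert (codei : forall t a b t' a' b', fld R t -> fld R a -> fld R b ->
    fld R t' -> fld R a' -> fld R b' -> code t a b = code t' a' b' -> t = t' /\ a = a' /\ b = b').
  { intros t a b t' a' b' ? ? ? ? ? ? E. apply ji in E; auto. apply fi in E; auto.
    destruct E as [E1 E2]. apply fi in E2; auto. }
  set (N := fun (q : (J * J) * J) => exists a b, fld R a /\ fld R b /\
    (q = ((j a, b), code t1 a b) \/ q = ((a, j b), code t2 a b) \/
     q = ((j a, j b), code t3 a b))).
  assert (NR : forall p z, N (p, z) -> ~ (fld R (fst p) /\ fld R (snd p))).
  { intros p z [a [b [ha [hb [E|[E|E]]]]]] [u v]; inversion E; subst; cbn in u, v;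
    first [exact (jn _ ha u)|exact (jn _ hb v)]. }
  assert (NZ : forall p z, N (p, z) -> ~ fld R z).
  { intros p z [a [b [ha [hb [E|[E|E]]]]]]; inversion E; subst; auto. }
  exists (fun q => R q \/ N q). split; [split; [|split]|split].
  - intros p z z' [h|h] [h'|h']; eauto.
    + exfalso. apply (NR _ _ h'). destruct p. apply RA in h. tauto.
    + exfalso. apply (NR _ _ h). destruct p. apply RA in h'. tauto.
    + destruct h as [a [b [ha [hb E]]]]. destruct h' as [a' [b' [ha' [hb' E']]]].
      destruct E as [E|[E|E]], E' as [E'|[E'|E']]; inversion E; inversion E'; subst p; clear E E';
      match goal with H : (_, _) = (_, _) |- _ => injection H; intros; subst end;
      repeat match goal with H : j _ = j _ |- _ => apply ji in H; [subst|assumption|assumption] end;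
      try reflexivity; exfalso;
      match goal with L : fld R ?x, K : fld R (j ?x) |- _ => exact (jn x L K) end.
  - intros p p' z [h|h] [h'|h']; eauto.
    + exfalso. apply (NZ _ _ h'). destruct p. apply RA in h. tauto.
    + exfalso. apply (NZ _ _ h). destruct p'. apply RA in h'. tauto.
    + destruct h as [a [b [ha [hb E]]]]. destruct h' as [a' [b' [ha' [hb' E']]]].
      destruct E as [E|[E|E]], E' as [E'|[E'|E']]; inversion E; inversion E'; subst z; clear E E';
      match goal with H : code _ _ _ = code _ _ _ |- _ =>
        apply codei in H; [|assumption..]; destruct H as [? [? ?]]; subst; congruence end.
  - assert (Q : forall x, fld (fun q => R q \/ N q) x ->
      fld R x \/ exists a, fld R a /\ x = j a).
    { intros x [a [b [z [[h|h] e]]]].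
      - apply RA in h. left. destruct e as [<-|[<-|<-]]; tauto.
      - destruct e as [<-|[<-|<-]]; [| |right; eauto];
        destruct h as [a' [b' [ha [hb [E|[E|E]]]]]]; inversion E; subst; eauto. }
    intros x y hx hy.
    destruct (Q x hx) as [ax|[a [ha ->]]], (Q y hy) as [ay|[b [hb ->]]].
    + destruct (Rt x y) as [z hz]; eauto.
    + exists (code t2 x b). right. exists x, b. auto.
    + exists (code t1 a y). right. exists a, y. auto.
    + exists (code t3 a b). right. exists a, b. auto.
  - auto.
  - exists ((j t1, j t1), code t3 t1 t1). split.
    + right. exists t1, t1. auto.
    + intros h. apply RA in h. apply (jn t1); tauto.
Qed.

(** Let [D] be the field of a maximal graph. If the complement of [D] contains a copy of [D], the
    graph can be extended; otherwise the complement embeds into [D], and then [J] itself does. *)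
Theorem card_le_square (J : Type) : card_le nat J -> card_le (J * J) J.
Proof.
  intros [c ci].
  destruct (zorn_above square_graph _ (square_graph_nat c ci)) as [M [[Mf [Mi Mt]] [M0 Mmax]]].
  { intros F _. apply square_graph_chain. }
  assert (cM : forall n, fld M (c n)).
  { intros n. exists (c n), (c n), (c (to_nat (n, n))). split; auto. apply M0. eauto. }
  assert (cn : forall m n, m <> n -> c m <> c n) by (intros m n h E; auto).
  destruct (card_le_total {x | fld M x} {x | ~ fld M x}) as [[j ji]|[k ki]].
  - exfalso.
    destruct (square_graph_extend M
      (fun x => match excluded_middle_informative (fld M x) with
        | left h => proj1_sig (j (exist _ x h)) | right _ => x end) (c 0) (c 1) (c 2))
      as [R' [PR' [MR' [p [hp np]]]]]; auto.
    + split; auto.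
    + intros x hx. destruct (excluded_middle_informative (fld M x)) as [h|h]; [|contradiction].
      apply proj2_sig.
    + intros x y hx hy.
      destruct (excluded_middle_informative (fld M x)) as [h|h]; [|contradiction].
      destruct (excluded_middle_informative (fld M y)) as [h'|h']; [|contradiction].
      intros E. apply eq_sig_hprop in E; [|intros; apply proof_irrelevance].
      apply ji in E. now inversion E.
    + exact (np (Mmax R' PR' MR' p hp)).
  - destruct (choice_on (A := J * J) (c 0) (fun p => fld M (fst p) /\ fld M (snd p))
      (fun p z => M (p, z))) as [f hf].
    { intros [x y] [hx hy]. apply Mt; assumption. }
    assert (fA : forall x y, fld M x -> fld M y -> fld M (f (x, y))).
    { intros x y hx hy. exists x, y, (f (x, y)). split; [apply hf; cbn; auto|auto]. }
    assert (fi : forall x y x' y', fld M x -> fld M y -> fld M x' -> fld M y' ->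
      f (x, y) = f (x', y') -> x = x' /\ y = y').
    { intros x y x' y' hx hy hx' hy' E.
      assert (E' : (x, y) = (x', y')).
      { apply (Mi _ _ (f (x, y))); [|rewrite E]; apply hf; auto. }
      now injection E'. }
    (* [g] embeds [J] into [D]: the first entry [c 0] or [c 1] records whether [x] lies in [D] or
       was brought there by [k]. *)
    set (g := fun x => match excluded_middle_informative (fld M x) with
      | left _ => f (c 0, x)
      | right h => f (c 1, proj1_sig (k (exist (fun x => ~ fld M x) x h))) end).
    assert (gM : forall x, fld M (g x)).
    { intros x. unfold g. destruct (excluded_middle_informative _); apply fA; auto.
      apply proj2_sig. }
    assert (gi : forall x y, g x = g y -> x = y).
    { intros x y. unfold g.
      destruct (excluded_middle_informative (fld M x)), (excluded_middle_informative (fld M y));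
      intros E; apply fi in E; auto; try apply proj2_sig; destruct E as [E1 E2];
      try (apply cn in E1; [contradiction|discriminate]); auto.
      apply eq_sig_hprop in E2; [|intros; apply proof_irrelevance].
      apply ki in E2. now inversion E2. }
    exists (fun p => f (g (fst p), g (snd p))). intros [x y] [x' y'] E. cbn in E.
    apply fi in E; auto. destruct E as [E1 E2]. apply gi in E1, E2. now subst.
Qed.

(** * Cardinal arithmetic *)

Lemma card_le_surj {A B : Type} (a0 : A) :
  card_le A B -> exists g : B -> A, forall a, exists b, g b = a.
Proof.
  intros [f fi].
  destruct (choice_on a0 (fun b => exists a, f a = b) (fun b a => f a = b)) as [g hg]; [auto|].
  exists g. intros a. exists (f a). apply fi, hg. eauto.
Qed.

Lemma surj_card_le {A B : Type} (f : B -> A) :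
  (forall a, exists b, f b = a) -> card_le A B.
Proof.
  intros H. destruct (choice_fun _ H) as [g hg]. exists g. intros a a' E.
  now rewrite <- (hg a), E.
Qed.

Lemma card_le_fun_l {A B : Type} (C : Type) (a0 : A) :
  card_le A B -> card_le (A -> C) (B -> C).
Proof.
  intros h. destruct (card_le_surj a0 h) as [g hg]. exists (fun u b => u (g b)).
  intros u v E. apply functional_extensionality. intros a. destruct (hg a) as [b <-].
  exact (f_equal (fun w => w b) E).
Qed.

Lemma card_le_fun_r {A B : Type} (C : Type) : card_le A B -> card_le (C -> A) (C -> B).
Proof.
  intros [f fi]. exists (fun u c => f (u c)). intros u v E. apply functional_extensionality.
  intros c. apply fi. exact (f_equal (fun w => w c) E).
Qed.

Lemma card_le_prod {A A' B B' : Type} :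
  card_le A A' -> card_le B B' -> card_le (A * B) (A' * B').
Proof.
  intros [f fi] [g gi]. exists (fun p => (f (fst p), g (snd p))).
  intros [a b] [a' b'] E. injection E as E1 E2. apply fi in E1. apply gi in E2. now subst.
Qed.

Lemma card_le_list {A B : Type} : card_le A B -> card_le (list A) (list B).
Proof.
  intros [f fi]. exists (map f). intros l. induction l as [|a l IH]; intros [|a' l'] E;
  try discriminate; auto. injection E as E1 E2. apply fi in E1. apply IH in E2. now subst.
Qed.

(** Lists become nested pairs, with [x] marking the empty list and [y] marking a cons. *)
Lemma card_le_list_of_square {A : Type} (x y : A) :
  x <> y -> card_le (A * A) A -> card_le (list A) A.
Proof.
  intros n [p pi].
  exists (fix enc l := match l with
    | [] => p (x, x) | a :: l' => p (y, p (a, enc l')) end).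
  intros l. induction l as [|a l IH]; intros [|a' l'] E; auto; apply pi in E;
  injection E; intros E1; try congruence.
  apply pi in E1. injection E1. intros E2 ->. apply IH in E2. now subst.
Qed.

Lemma card_le_list_inf {A J : Type} : card_le nat J -> card_le A J -> card_le (list A) J.
Proof.
  intros hJ h. apply card_le_trans with (list J); [now apply card_le_list|].
  destruct hJ as [c ci].
  apply card_le_list_of_square with (c 0) (c 1).
  - intros E. apply ci in E. discriminate.
  - apply card_le_square. now exists c.
Qed.

Lemma card_le_option_inf {A J : Type} : card_le nat J -> card_le A J -> card_le (option A) J.
Proof.
  intros hJ h. apply card_le_trans with (list A); [|now apply card_le_list_inf].
  exists (fun o => match o with Some a => [a] | None => [] end).
  intros [a|] [a'|] E; congruence.
Qed.

Lemma card_le_pow (J : Type) : card_le J (J -> bool).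
Proof.
  exists (fun i j => if excluded_middle_informative (i = j) then true else false).
  intros i i' E. apply (f_equal (fun u => u i')) in E.
  destruct (excluded_middle_informative (i = i')); [assumption|].
  now destruct (excluded_middle_informative (i' = i')).
Qed.

(** Currying and the square law: [(2^J)^J = 2^(J×J) = 2^J]. *)
Lemma card_le_fun_pow (J : Type) : card_le nat J -> card_le (J -> J -> bool) (J -> bool).
Proof.
  intros hJ. pose proof hJ as [c _].
  apply card_le_trans with (J * J -> bool).
  - exists (fun u p => u (fst p) (snd p)). intros u v E.
    apply functional_extensionality. intros i. apply functional_extensionality. intros j.
    exact (f_equal (fun w => w (i, j)) E).
  - apply card_le_fun_l; [exact (c 0, c 0)|]. now apply card_le_square.
Qed.

(** A pair is stored as a function on [J] with its first entry at [c 0] and its second everywhere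
    else, in particular at [c 1]. *)
Lemma card_le_pow_square (J : Type) :
  card_le nat J -> card_le ((J -> bool) * (J -> bool)) (J -> bool).
Proof.
  intros hJ. apply card_le_trans with (J -> J -> bool); [|now apply card_le_fun_pow].
  destruct hJ as [c ci].
  exists (fun p j => if excluded_middle_informative (j = c 0) then fst p else snd p).
  intros [a b] [a' b'] E. f_equal.
  - apply (f_equal (fun w => w (c 0))) in E.
    now destruct (excluded_middle_informative (c 0 = c 0)).
  - apply (f_equal (fun w => w (c 1))) in E.
    destruct (excluded_middle_informative (c 1 = c 0)) as [h|h]; [|assumption].
    apply ci in h. discriminate.
Qed.

Lemma nat_le_pow {J : Type} : card_le nat J -> card_le nat (J -> bool).
Proof. intros hJ. apply card_le_trans with J; [assumption|apply card_le_pow]. Qed.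

(** This counts the ways to attach to each network element a finite union of finite intersections of
    sets indexed by pairs of points. *)
Lemma card_le_fun_list_pow (J : Type) :
  card_le nat J -> card_le (J -> list (list ((J -> bool) * (J -> bool)))) (J -> bool).
Proof.
  intros hJ. apply card_le_trans with (J -> J -> bool); [|now apply card_le_fun_pow].
  apply card_le_fun_r. apply card_le_list_inf; [now apply nat_le_pow|].
  apply card_le_list_inf; [now apply nat_le_pow|]. now apply card_le_pow_square.
Qed.

(* A well-founded tree is determined by the labels along its finite branches. *)
Inductive tree (L I : Type) : Type :=
| leaf : tree L I
| node : L -> (I -> tree L I) -> tree L I.
Arguments leaf {L I}.
Arguments node {L I}.

Fixpoint label_at {L I : Type} (t : tree L I) (p : list I) : option L :=
  match t, p with
  | leaf, _ => None
  | node s _, [] => Some s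
  | node _ f, i :: p' => label_at (f i) p'
  end.

Lemma card_le_tree (L I : Type) : card_le (tree L I) (list I -> option L).
Proof.
  exists label_at. intros t. induction t as [|s f IH]; intros [|s' f'] E; auto.
  - apply (f_equal (fun u => u [])) in E. discriminate.
  - apply (f_equal (fun u => u [])) in E. discriminate.
  - assert (Es := f_equal (fun u => u []) E). injection Es as ->. f_equal.
    apply functional_extensionality. intros i. apply IH.
    apply functional_extensionality. intros p. exact (f_equal (fun u => u (i :: p)) E).
Qed.

(** By [card_le_tree] a tree is a map from a set of size at most [J] to another such set, and [J^J]
    is at most [(2^J)^J = 2^J]. *)
Lemma card_le_tree_pow (J L : Type) :
  card_le nat J -> card_le L J -> card_le (tree L (list J)) (J -> bool).
Proof.
  intros hJ hL. apply card_le_trans with (list (list J) -> option L); [apply card_le_tree|].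
  apply card_le_trans with (list (list J) -> J -> bool).
  - apply card_le_fun_r. apply card_le_trans with J; [now apply card_le_option_inf|].
    apply card_le_pow.
  - apply card_le_trans with (J -> J -> bool); [|now apply card_le_fun_pow].
    apply card_le_fun_l; [exact []|].
    do 2 (apply card_le_list_inf; [assumption|]). apply card_le_refl.
Qed.

(** * Topological preliminaries *)

Lemma open_local {T : Type} (op : (T -> Prop) -> Prop) (U : T -> Prop) :
  is_topology op ->
  (forall x, U x -> exists V, op V /\ V x /\ forall y, V y -> U y) -> op U.
Proof.
  intros [_ [_ Hun]] H.
  replace U with (fun x => exists V, (op V /\ forall y, V y -> U y) /\ V x).
  - apply Hun. tauto.
  - apply pred_ext. intros x. split.
    + intros [V [[_ h] Vx]]. auto.
    + intros Ux. destruct (H x Ux) as [V [h1 [h2 h3]]]. eauto.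
Qed.

Lemma open_ext {T : Type} (op : (T -> Prop) -> Prop) (U V : T -> Prop) :
  op U -> (forall x, U x <-> V x) -> op V.
Proof. intros h E. now rewrite <- (pred_ext U V E). Qed.

Lemma open_empty {T : Type} (op : (T -> Prop) -> Prop) :
  is_topology op -> op (fun _ => False).
Proof. intros Ht. apply open_local; tauto. Qed.

Lemma open_union {T : Type} (op : (T -> Prop) -> Prop) (U V : T -> Prop) :
  is_topology op -> op U -> op V -> op (fun x => U x \/ V x).
Proof. intros Ht hU hV. apply (open_local op); auto. intros x [h|h]; eauto. Qed.

Lemma open_Union {T I : Type} (op : (T -> Prop) -> Prop) (U : I -> T -> Prop) :
  is_topology op -> (forall i, op (U i)) -> op (fun x => exists i, U i x).
Proof. intros Ht hU. apply (open_local op); auto. intros x [i h]. exists (U i). eauto. Qed.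

Lemma open_list_inter {T I : Type} (op : (T -> Prop) -> Prop) (U : I -> T -> Prop) (l : list I) :
  is_topology op -> (forall i, op (U i)) -> op (fun x => forall i, In i l -> U i x).
Proof.
  intros [Htop [Hint _]] hU. induction l as [|i l IH].
  - apply (open_ext op) with (fun _ => True); [assumption|]. cbn; tauto.
  - apply (open_ext op) with (fun x => U i x /\ forall j, In j l -> U j x); [now apply Hint|].
    intros x. split.
    + intros [h1 h2] j [<-|h]; auto.
    + intros h. split; [apply h; now left|intros j hj; apply h; now right].
Qed.

Lemma closed_compl {T : Type} (op : (T -> Prop) -> Prop) (U : T -> Prop) :
  op U -> closed op (fun x => ~ U x).
Proof. intros h. apply (open_ext op U); [assumption|]. intros x. split; [tauto|apply NNPP]. Qed.

Lemma closed_Inter {T I : Type} (op : (T -> Prop) -> Prop) (D : I -> Prop) (Z : I -> T -> Prop) :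
  is_topology op -> (forall i, D i -> closed op (Z i)) ->
  closed op (fun x => forall i, D i -> Z i x).
Proof.
  intros Ht h. apply (open_local op); auto. intros x hx.
  apply not_all_ex_not in hx. destruct hx as [i hi].
  apply imply_to_and in hi. destruct hi as [Di nZ].
  exists (fun y => ~ Z i y). split; [now apply h|]. split; auto.
Qed.

Lemma open_neq {T : Type} (op : (T -> Prop) -> Prop) (x : T) :
  is_topology op -> hausdorff op -> op (fun y => y <> x).
Proof.
  intros Ht Hh. apply (open_local op); auto. intros y n.
  destruct (Hh y x n) as [U [V [hU [hV [Uy [Vx d]]]]]]. exists U. repeat split; auto.
  intros z Uz ->. exact (d x (conj Uz Vx)).
Qed.

(** * Regularity and compactness *)

Definition regular {T : Type} (op : (T -> Prop) -> Prop) : Prop :=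
  forall (x : T) (U : T -> Prop), op U -> U x ->
    exists V Z, op V /\ closed op Z /\ V x /\ (forall y, V y -> Z y) /\ forall y, Z y -> U y.

(* Compactness as an induction principle for ideals of sets. *)
Definition compact_set {T : Type} (op : (T -> Prop) -> Prop) (C : T -> Prop) : Prop :=
  forall P : (T -> Prop) -> Prop,
    P (fun _ => False) ->
    (forall A B : T -> Prop, P B -> (forall x, A x -> B x) -> P A) ->
    (forall A B : T -> Prop, P A -> P B -> P (fun x => A x \/ B x)) ->
    (forall x, C x -> exists U, op U /\ U x /\ P U) -> P C.

(** The cover to be reduced consists of all open members of the ideal [P]. *)
Lemma compact_set_of_subspace {T : Type} (op : (T -> Prop) -> Prop) (C : T -> Prop) :
  compact (subspace op C) -> compact_set op C.
Proof.
  intros Hc P P0 Pm Pu H.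
  destruct (Hc {U | op U /\ P U} (fun U x => proj1_sig U (proj1_sig x))) as [l hl].
  - intros [U [hU PU]]. exists U. cbn. tauto.
  - intros [x Cx]. destruct (H x Cx) as [U [hU [Ux PU]]].
    now exists (exist _ U (conj hU PU)).
  - apply Pm with (fun x => exists U, In U l /\ proj1_sig U x).
    + clear hl. induction l as [|[U [hU PU]] l IH].
      * apply Pm with (1 := P0). intros x [U [[] _]].
      * apply Pm with (1 := Pu _ _ PU IH). intros x [V [[<-|h] Vx]]; [left|right]; eauto.
    + intros x Cx. apply (hl (exist _ x Cx)).
Qed.

Lemma subspace_compact {T : Type} (op : (T -> Prop) -> Prop) (C : T -> Prop) :
  compact_set op C -> compact (subspace op C).
Proof.
  intros Hc I U hU hcov. destruct (choice_fun _ hU) as [V hV].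
  destruct (Hc (fun W => exists l : list I, forall x, W x -> C x ->
    exists i, In i l /\ V i x)) as [l hl].
  - exists []. tauto.
  - intros A B [l hl] AB. exists l. auto.
  - intros A B [l hl] [l' hl']. exists (l ++ l'). intros x [h|h] Cx;
    [destruct (hl x h Cx) as [i [? ?]]|destruct (hl' x h Cx) as [i [? ?]]];
    exists i; rewrite in_app_iff; auto.
  - intros x Cx. destruct (hcov (exist _ x Cx)) as [i hi]. exists (V i).
    split; [apply hV|]. apply hV in hi. split; [exact hi|].
    exists [i]. intros y Vy _. exists i. cbn; auto.
  - exists l. intros [x Cx]. destruct (hl x Cx Cx) as [i [h1 h2]]. exists i. split; auto.
    now apply hV.
Qed.

Lemma compact_ind {T : Type} (op : (T -> Prop) -> Prop) :
  compact op -> compact_set op (fun _ => True).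
Proof.
  intros Hc. apply compact_set_of_subspace. intros I U hU hcov.
  destruct (choice_fun _ hU) as [V hV].
  destruct (Hc I V) as [l hl].
  - intros i. apply hV.
  - intros x. destruct (hcov (exist _ x Logic.I)) as [i hi]. exists i. now apply hV in hi.
  - exists l. intros [x t]. destruct (hl x) as [i [h1 h2]]. exists i. split; auto. now apply hV.
Qed.

(** The induction over [C] runs on the ideal of sets whose trace on [Z] satisfies [P]; a point
    outside [Z] has the complement of [Z] as a neighbourhood with empty trace. *)
Lemma compact_set_closed {T : Type} (op : (T -> Prop) -> Prop) (C Z : T -> Prop) :
  compact_set op C -> closed op Z -> (forall x, Z x -> C x) -> compact_set op Z.
Proof.
  intros Hc hZ ZC P P0 Pm Pu H.
  apply Pm with (fun x => C x /\ Z x); [|auto].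
  apply (Hc (fun W => P (fun x => W x /\ Z x))).
  - apply Pm with (1 := P0). tauto.
  - intros A B PB AB. apply Pm with (1 := PB). intros x [? ?]; auto.
  - intros A B PA PB. apply Pm with (1 := Pu _ _ PA PB). tauto.
  - intros x Cx. destruct (classic (Z x)) as [Zx|nZ].
    + destruct (H x Zx) as [U [hU [Ux PU]]]. exists U. repeat split; auto.
      apply Pm with (1 := PU). tauto.
    + exists (fun y => ~ Z y). repeat split; auto. apply Pm with (1 := P0). tauto.
Qed.

(** The ideal consists of the sets [W] for which the part of [W] outside [U] can be separated from
    [x] by disjoint open sets. *)
Lemma compact_hausdorff_regular {T : Type} (op : (T -> Prop) -> Prop) :
  is_topology op -> compact op -> hausdorff op -> regular op.
Proof.
  intros Ht Hc Hh x U hU Ux. pose proof Ht as [Htop [Hint _]].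
  destruct (compact_ind op Hc (fun W => exists A B, op A /\ op B /\ A x /\
    (forall y, ~ (A y /\ B y)) /\ forall y, W y -> ~ U y -> B y))
    as [A [B [hA [hB [Ax [d h]]]]]].
  - exists (fun _ => True), (fun _ => False). repeat split; try tauto. now apply open_empty.
  - intros W W' [A [B [hA [hB [Ax [d h]]]]]] WW. exists A, B. repeat split; auto.
  - intros W W' [A [B [hA [hB [Ax [d h]]]]]] [A' [B' [hA' [hB' [Ax' [d' h']]]]]].
    exists (fun y => A y /\ A' y), (fun y => B y \/ B' y).
    split; [now apply Hint|]. split; [now apply open_union|]. split; [tauto|]. split.
    + intros y [[a a'] [b|b]]; [apply (d y)|apply (d' y)]; tauto.
    + intros y [w|w] n; auto.
  - intros y _. destruct (classic (U y)) as [Uy|nU].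
    + exists U. repeat split; auto. exists (fun _ => True), (fun _ => False).
      repeat split; try tauto. now apply open_empty.
    + destruct (Hh x y) as [A [B [hA [hB [Ax [By d]]]]]]; [congruence|].
      exists B. repeat split; auto. exists A, B. repeat split; auto.
  - exists A, (fun y => ~ B y). repeat split; auto.
    + now apply closed_compl.
    + intros y Ay By. exact (d y (conj Ay By)).
    + intros y nB. apply NNPP. auto.
Qed.

Lemma subspace_topology {T : Type} (op : (T -> Prop) -> Prop) (C : T -> Prop) :
  is_topology op -> is_topology (subspace op C).
Proof.
  intros Ht. pose proof Ht as [Htop [Hint _]]. split; [|split].
  - exists (fun _ => True). tauto.
  - intros U V [U' [hU EU]] [V' [hV EV]]. exists (fun x => U' x /\ V' x). split; [auto|].
    intros x. rewrite EU, EV. tauto.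
  (* The union of all open sets whose trace belongs to [F] serves as witness, which avoids choosing
     one extension per member. *)
  - intros F hF. exists (fun x => exists W : {W | op W /\ exists U, F U /\
      forall x : {x | C x}, U x <-> W (proj1_sig x)}, proj1_sig W x). split.
    + apply open_Union; auto. intros W. apply (proj2_sig W).
    + intros x. split.
      * intros [U [FU Ux]]. destruct (hF U FU) as [V [hV EV]].
        assert (h : op V /\ exists U, F U /\ forall x : {x | C x}, U x <-> V (proj1_sig x))
          by eauto.
        exists (exist _ V h). now apply EV.
      * intros [[W [hW [U [FU E]]]] Wx]. exists U. split; auto. now apply E.
Qed.

Lemma subspace_hausdorff {T : Type} (op : (T -> Prop) -> Prop) (C : T -> Prop) :
  hausdorff op -> hausdorff (subspace op C).
Proof.
  intros Hh [x Cx] [y Cy] n.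
  destruct (Hh x y) as [U [V [hU [hV [Ux [Vy d]]]]]].
  - intros E. subst y. apply n. f_equal. apply proof_irrelevance.
  - exists (fun z => U (proj1_sig z)), (fun z => V (proj1_sig z)).
    repeat split; auto; [exists U|exists V]; tauto.
Qed.

(** * Compact spaces of small pseudocharacter *)

(* The pseudobase is first shrunk by regularity; compactness then turns the finite
   intersections of the shrunk sets into a base. *)
Lemma compact_local_base {T J : Type} (op : (T -> Prop) -> Prop) :
  is_topology op -> compact op -> hausdorff op -> psi_le op J ->
  exists Q : T -> J -> T -> Prop, (forall x j, op (Q x j)) /\ (forall x j, Q x j x) /\
    forall x U, op U -> U x -> exists l, forall y, (forall j, In j l -> Q x j y) -> U y.
Proof.
  intros Ht Hc Hh Hpsi.
  assert (H : forall x, exists V : J -> T -> Prop, (forall j, op (V j)) /\ (forall j, V j x) /\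
    forall U, op U -> U x -> exists l, forall y, (forall j, In j l -> V j y) -> U y).
  { intros x. destruct (Hpsi x) as [S [P [hP hx]]].
    (* For [j] in [S] an open set and a closed set are squeezed between [x] and [P j]; the other
       indices receive the whole space. *)
    assert (H : forall j, exists VZ : (T -> Prop) * (T -> Prop),
      op (fst VZ) /\ closed op (snd VZ) /\ fst VZ x /\
      (forall y, fst VZ y -> snd VZ y) /\ (S j -> forall y, snd VZ y -> P j y)).
    { intros j. destruct (classic (S j)) as [Sj|nS].
      - destruct (compact_hausdorff_regular op Ht Hc Hh x (P j)) as [V [Z h]];
          try apply hP; auto.
        exists (V, Z). cbn. tauto.
      - exists ((fun _ => True), (fun _ => True)). cbn. repeat split; try tauto.
        + apply Ht.
        + apply (open_ext op) with (fun _ => False); [now apply open_empty|tauto]. }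
    destruct (choice_fun _ H) as [VZ hVZ].
    exists (fun j => fst (VZ j)). split; [|split]; try (intros; apply hVZ).
    intros U hU Ux.
    destruct (compact_ind op Hc (fun W => exists l, forall y, W y ->
      (forall j, In j l -> snd (VZ j) y) -> U y)) as [l hl].
    - exists []. tauto.
    - intros A B [l hl] AB. exists l. auto.
    - intros A B [l hl] [l' hl']. exists (l ++ l').
      intros y [h|h] k; [apply hl|apply hl']; auto; intros j hj; apply k;
        apply in_app_iff; auto.
    - intros y _. destruct (classic (y = x)) as [->|n].
      + exists U. repeat split; auto. exists []. auto.
      + assert (K : exists j, ~ snd (VZ j) y).
        { apply not_all_ex_not. intros h. apply n, hx. intros j Sj.
          now apply hVZ. }
        destruct K as [j hj]. exists (fun y => ~ snd (VZ j) y).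
        split; [apply hVZ|]. split; [assumption|]. exists [j]. intros z nz k.
        exfalso. apply nz, k. now left.
    - exists l. intros y h. apply hl; auto. intros j hj. apply hVZ. auto. }
  destruct (choice_fun _ H) as [Q hQ]. exists Q. repeat split; intros; apply hQ; auto.
Qed.

(* Arhangel'skii's theorem.  The closing-off argument is carried out inside a
   well-founded tree type: a node either takes the limit of a net of points already
   obtained, or picks a point outside a finite union of basic neighbourhoods of them. *)
Theorem compact_card_le_pow_psi {T J : Type} (op : (T -> Prop) -> Prop) :
  is_topology op -> compact op -> hausdorff op -> card_le nat J -> psi_le op J ->
  card_le T (J -> bool).
Proof.
  intros Ht Hc Hh HJ Hpsi.
  destruct (classic (exists t : T, True)) as [[t0 _]|nT];
    [|exists (fun _ _ => true); intros a; exfalso; eauto].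
  destruct (compact_local_base op Ht Hc Hh Hpsi) as [Q [Qop [Qx Qb]]].
  pose proof HJ as [c _]. set (j0 := c 0).
  set (B := fun (x : T) (l : list J) y => forall j, In j l -> Q x j y).
  assert (Bop : forall x l, op (B x l)) by (intros; now apply open_list_inter).
  assert (Bx : forall x l, B x l x) by (intros x l j _; apply Qx).
  (* Finite lists over [J] name the basic neighbourhoods of a point, so nets indexed by such lists
     suffice to reach every point of a closure. *)
  set (lim := fun (g : list J -> T) x => forall l, B x l (g l)).
  assert (lim_unique : forall g x y, lim g x -> lim g y -> x = y).
  { intros g x y hx hy. apply NNPP. intros n.
    destruct (Hh x y n) as [U [V [hU [hV [Ux [Vy d]]]]]].
    destruct (Qb x U hU Ux) as [l hl]. destruct (Qb y V hV Vy) as [l' hl'].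
    apply (d (g (l ++ l'))). split; [apply hl|apply hl']; intros j hj;
    [apply (hx (l ++ l'))|apply (hy (l ++ l'))]; apply in_app_iff; auto. }
  (* Children of a node are indexed by lists over [J]; the list [repeat j0 m] of length [m] stands
     for the number [m]. *)
  set (avoid := fun (s : list (list J)) (g : list J -> T) z =>
    forall m, m < length s -> ~ B (g (repeat j0 m)) (nth m s []) z).
  set (eval := fix eval (t : tree (option (list (list J))) (list J)) : T :=
    match t with
    | leaf => t0
    | node None f => epsilon (inhabits t0) (lim (fun l => eval (f l)))
    | node (Some s) f => epsilon (inhabits t0) (avoid s (fun l => eval (f l)))
    end).
  set (A := fun x => exists t, eval t = x).
  assert (Alim : forall g x, (forall l, A (g l)) -> lim g x -> A x).
  { intros g x Ag hx. destruct (choice_fun _ Ag) as [f hf]. exists (node None f).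
    assert (E : (fun l => eval (f l)) = g) by now apply functional_extensionality.
    apply (lim_unique g); [|assumption]. cbn. rewrite E. apply epsilon_spec. eauto. }
  (* A point in the closure of [A] is the limit of a net in [A], hence already the value of a limit
     node. *)
  assert (Acl : op (fun x => ~ A x)).
  { apply (open_local op); auto. intros x nA. apply NNPP. intros K. apply nA.
    assert (H : forall l, exists y, B x l y /\ A y).
    { intros l. apply NNPP. intros h. apply K. exists (B x l). repeat split; auto.
      intros y By Ay. eauto. }
    destruct (choice_fun _ H) as [g hg]. apply (Alim g); [intros l|intros l]; apply hg. }
  apply card_le_trans with (tree (option (list (list J))) (list J)).
  2: { apply card_le_tree_pow; [assumption|]. apply card_le_option_inf; [assumption|].
       do 2 (apply card_le_list_inf; [assumption|]). apply card_le_refl. }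
  apply surj_card_le with eval. intros z. change (A z). apply NNPP. intros nA.
  (* Assuming [z] is outside [A], finitely many basic neighbourhoods of points of [A] cover [A] and
     still omit [z]. *)
  destruct (compact_ind op Hc (fun W => exists s : list (tree _ (list J) * list J),
    (forall p, In p s -> ~ B (eval (fst p)) (snd p) z) /\
    forall y, W y -> A y -> exists p, In p s /\ B (eval (fst p)) (snd p) y)) as [s [sz hs]].
  - exists []. cbn. tauto.
  - intros W W' [s [sz hs]] WW. exists s. auto.
  - intros W W' [s [sz hs]] [s' [sz' hs']]. exists (s ++ s'). split.
    + intros p hp. apply in_app_iff in hp. destruct hp; auto.
    + intros y [h|h] Ay; [destruct (hs y h Ay) as [p [? ?]]|destruct (hs' y h Ay) as [p [? ?]]];
      exists p; rewrite in_app_iff; auto.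
  - intros y _. destruct (classic (A y)) as [[t Et]|n].
    + destruct (Qb y (fun w => w <> z)) as [l hl].
      * now apply open_neq.
      * intros ->. apply nA. now exists t.
      * exists (B y l). repeat split; auto. exists [(t, l)]. split.
        -- intros p [<-|[]] h. cbn in h. rewrite Et in h. now apply (hl z).
        -- intros w Bw _. exists (t, l). cbn. rewrite Et. auto.
    + exists (fun w => ~ A w). repeat split; auto. exists []. cbn. tauto.
  (* The finite cover becomes a node. Since [z] avoids the cover, [epsilon] selects a point that
     avoids it too; but this point lies in [A], which is covered. *)
  - set (t := node (Some (map snd s)) (fun i => nth (length i) (map fst s) leaf)).
    pose proof (fun m => map_nth fst s (leaf, []) m) as nth_fst.
    pose proof (fun m => map_nth snd s (leaf, []) m) as nth_snd.
    cbn [fst snd] in nth_fst, nth_snd.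
    assert (K : avoid (map snd s) (fun l => eval (nth (length l) (map fst s) leaf)) (eval t)).
    { apply (epsilon_spec (inhabits t0)). exists z. intros m hm.
      rewrite length_map in hm. rewrite repeat_length, nth_fst, nth_snd.
      now apply sz, nth_In. }
    destruct (hs (eval t) Logic.I) as [p [hp hB]]; [now exists t|].
    destruct (In_nth s p (leaf, []) hp) as [m [hm Em]].
    apply (K m); [now rewrite length_map|].
    now rewrite repeat_length, nth_fst, nth_snd, Em.
Qed.

(** * Lindelof Sigma-spaces *)

(* The Lindelof Sigma-property without reference to a compactification: a network of
   size [J] modulo a cover of [Y] by compact subsets. *)
Definition sigma_set {T : Type} (op : (T -> Prop) -> Prop) (J : Type) (Y : T -> Prop) : Prop :=
  exists N : J -> T -> Prop, forall y, Y y -> exists C : T -> Prop,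
    compact_set op C /\ C y /\ (forall x, C x -> Y x) /\
    forall U, op U -> (forall x, C x -> U x) -> exists j, N j y /\ forall x, N j x -> U x.

Lemma sigma_set_of_index {T I J : Type} (op : (T -> Prop) -> Prop) (Y : T -> Prop) (i0 : I) :
  card_le I J -> sigma_set op I Y -> sigma_set op J Y.
Proof.
  intros h [N hN]. destruct (card_le_surj i0 h) as [g hg]. exists (fun j => N (g j)).
  intros y Yy. destruct (hN y Yy) as [C [h1 [h2 [h3 h4]]]]. exists C. repeat split; auto.
  intros U hU CU. destruct (h4 U hU CU) as [i hi]. destruct (hg i) as [j <-]. now exists j.
Qed.

Lemma compact_singleton {T : Type} (op : (T -> Prop) -> Prop) (x : T) :
  compact_set op (fun y => y = x).
Proof.
  intros P _ Pm _ H. destruct (H x eq_refl) as [U [_ [Ux PU]]].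
  apply Pm with (1 := PU). now intros y ->.
Qed.

Lemma compact_image {T : Type} (op : (T -> Prop) -> Prop) (f : T -> T) (C : T -> Prop) :
  continuous op op f -> compact_set op C -> compact_set op (fun z => exists x, C x /\ z = f x).
Proof.
  intros hf Hc P P0 Pm Pu H.
  apply (Hc (fun W => P (fun z => exists x, W x /\ z = f x))).
  - apply Pm with (1 := P0). intros z [x [[] _]].
  - intros A B PB AB. apply Pm with (1 := PB). intros z [x [h E]]. eauto.
  - intros A B PA PB. apply Pm with (1 := Pu _ _ PA PB).
    intros z [x [[h|h] E]]; [left|right]; eauto.
  - intros x Cx. destruct (H (f x)) as [U [hU [Ux PU]]]; [eauto|].
    exists (fun y => U (f y)). split; [now apply hf|]. split; [assumption|].
    apply Pm with (1 := PU). now intros z [y [h ->]].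
Qed.

Lemma sigma_set_single {T J : Type} (op : (T -> Prop) -> Prop) (j0 : J) (x : T) :
  sigma_set op J (fun y => y = x).
Proof.
  exists (fun _ y => y = x). intros y ->. exists (fun y => y = x).
  split; [apply compact_singleton|]. split; [reflexivity|]. split; [auto|].
  intros U hU CU. exists j0. auto.
Qed.

Lemma sigma_set_image {T J : Type} (op : (T -> Prop) -> Prop) (f : T -> T) (Y : T -> Prop) :
  continuous op op f -> sigma_set op J Y -> sigma_set op J (fun z => exists x, Y x /\ z = f x).
Proof.
  intros hf [N hN]. exists (fun j z => exists x, N j x /\ z = f x).
  intros z [x [Yx ->]]. destruct (hN x Yx) as [C [h1 [h2 [h3 h4]]]].
  exists (fun z => exists x, C x /\ z = f x). split; [now apply compact_image|].
  split; [eauto|]. split; [intros z [y [h E]]; eauto|].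
  intros U hU CU. destruct (h4 (fun y => U (f y))) as [j [jx jU]].
  - now apply hf.
  - eauto.
  - exists j. split; [eauto|]. intros z [y [h ->]]. auto.
Qed.

Lemma sigma_set_Union {T J : Type} (op : (T -> Prop) -> Prop) (Y : nat -> T -> Prop) :
  card_le nat J -> (forall n, sigma_set op J (Y n)) -> sigma_set op J (fun x => exists n, Y n x).
Proof.
  intros hJ H. destruct (choice_fun _ H) as [N hN]. pose proof hJ as [c _].
  apply (sigma_set_of_index (I := (nat * J)%type)); [exact (0, c 0)| |].
  - apply card_le_trans with (J * J)%type; [|now apply card_le_square].
    apply card_le_prod; [assumption|apply card_le_refl].
  - exists (fun p => N (fst p) (snd p)). intros y [n Yy].
    destruct (hN n y Yy) as [C [h1 [h2 [h3 h4]]]]. exists C. repeat split; auto.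
    + intros x Cx. exists n. auto.
    + intros U hU CU. destruct (h4 U hU CU) as [j hj]. now exists (n, j).
Qed.

Lemma sigma_set_union {T J : Type} (op : (T -> Prop) -> Prop) (Y Z : T -> Prop) :
  card_le nat J -> sigma_set op J Y -> sigma_set op J Z -> sigma_set op J (fun x => Y x \/ Z x).
Proof.
  intros hJ hY hZ.
  replace (fun x => Y x \/ Z x) with
    (fun x => exists n, match n with 0 => Y | S _ => Z end x).
  - apply sigma_set_Union; [assumption|]. intros [|n]; assumption.
  - apply pred_ext. intros x. split.
    + intros [[|n] h]; auto.
    + intros [h|h]; [now exists 0|now exists 1].
Qed.

(** * Products of compact sets and of Sigma-sets under a continuous multiplication *)

Section Product.
Context {T : Type} (op : (T -> Prop) -> Prop) (mul : T -> T -> T).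
Context (Ht : is_topology op).
Context (Hmul : forall W x y, op W -> W (mul x y) ->
     exists U V, op U /\ op V /\ U x /\ V y /\ forall u v, U u -> V v -> W (mul u v)).

Definition set_mul (A B : T -> Prop) (z : T) : Prop := exists a b, A a /\ B b /\ z = mul a b.

(** For a fixed [a] in [C], induction over [D] produces one neighbourhood [U] of [a] with
    [P (set_mul U D)]; induction over [C] then finishes. *)
Lemma compact_mul (C D : T -> Prop) :
  compact_set op C -> compact_set op D -> compact_set op (set_mul C D).
Proof.
  intros hC hD P P0 Pm Pu H. apply (hC (fun U => P (set_mul U D))).
  - apply Pm with (1 := P0). intros z [a [b [[] _]]].
  - intros A B PB AB. apply Pm with (1 := PB). intros z [a [b [h1 [h2 h3]]]]. exists a, b. auto.
  - intros A B PA PB. apply Pm with (1 := Pu _ _ PA PB).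
    intros z [a [b [[h|h] [h2 h3]]]]; [left|right]; exists a, b; auto.
  - intros a Ca. pose proof Ht as [Htop [Hint _]].
    apply (hD (fun V => exists U, op U /\ U a /\ P (set_mul U V))).
    + exists (fun _ => True). repeat split; auto. apply Pm with (1 := P0).
      intros z [x [y [_ [[] _]]]].
    + intros A B [U [hU [Ua PU]]] AB. exists U. repeat split; auto.
      apply Pm with (1 := PU). intros z [x [y [h1 [h2 h3]]]]. exists x, y. auto.
    + intros A B [U [hU [Ua PU]]] [U' [hU' [Ua' PU']]]. exists (fun x => U x /\ U' x).
      repeat split; auto. apply Pm with (1 := Pu _ _ PU PU').
      intros z [x [y [h1 [[h2|h2] h3]]]]; [left|right]; exists x, y; tauto.
    + intros b Db. destruct (H (mul a b)) as [W [hW [Wab PW]]]; [now exists a, b|].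
      destruct (Hmul W a b hW Wab) as [U [V [hU [hV [Ua [Vb UV]]]]]].
      exists V. repeat split; auto. exists U. repeat split; auto.
      apply Pm with (1 := PW). intros z [x [y [h1 [h2 ->]]]]. auto.
Qed.

(* Wallace's theorem *)
Lemma compact_mul_nbhd (C D O : T -> Prop) :
  compact_set op C -> compact_set op D -> op O -> (forall z, set_mul C D z -> O z) ->
  exists U V, op U /\ op V /\ (forall x, C x -> U x) /\ (forall x, D x -> V x) /\
    forall z, set_mul U V z -> O z.
Proof.
  intros hC hD hO CDO. pose proof Ht as [Htop [Hint _]].
  apply (hC (fun A => exists U V, op U /\ op V /\ (forall x, A x -> U x) /\
    (forall x, D x -> V x) /\ forall z, set_mul U V z -> O z)).
  - exists (fun _ => False), (fun _ => True). repeat split; auto.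
    + now apply open_empty.
    + intros z [a [b [[] _]]].
  - intros A B [U [V [h1 [h2 [h3 [h4 h5]]]]]] AB. exists U, V. repeat split; auto.
  - intros A B [U [V [h1 [h2 [h3 [h4 h5]]]]]] [U' [V' [h1' [h2' [h3' [h4' h5']]]]]].
    exists (fun x => U x \/ U' x), (fun x => V x /\ V' x). repeat split; auto.
    + now apply open_union.
    + intros x [h|h]; auto.
    + intros z [a [b [[h|h] [[k k'] E]]]]; [apply h5|apply h5']; exists a, b; auto.
  - intros a Ca.
    destruct (hD (fun B => exists U V, op U /\ op V /\ U a /\
      (forall x, B x -> V x) /\ forall z, set_mul U V z -> O z)) as [U [V h]].
    + exists (fun _ => True), (fun _ => False). repeat split; auto.
      * now apply open_empty.
      * intros z [x [y [_ [[] _]]]].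
    + intros A B [U [V [h1 [h2 [h3 [h4 h5]]]]]] AB. exists U, V. repeat split; auto.
    + intros A B [U [V [h1 [h2 [h3 [h4 h5]]]]]] [U' [V' [h1' [h2' [h3' [h4' h5']]]]]].
      exists (fun x => U x /\ U' x), (fun x => V x \/ V' x). repeat split; auto.
      * now apply open_union.
      * intros x [h|h]; auto.
      * intros z [x [y [[k k'] [[h|h] E]]]]; [apply h5|apply h5']; exists x, y; auto.
    + intros b Db. destruct (Hmul O a b hO) as [U [V [hU [hV [Ua [Vb UV]]]]]].
      { apply CDO. now exists a, b. }
      exists V. repeat split; auto. exists U, V. repeat split; auto.
      intros z [x [y [h1 [h2 ->]]]]. auto.
    + exists U. split; [tauto|]. split; [tauto|]. exists U, V. repeat split; tauto || apply h.
Qed.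

(** The products of network elements form the new network: Wallace's theorem splits a neighbourhood
    of [C] times [D] into open factors, and each factor contains a network element. *)
Lemma sigma_set_mul {J : Type} (Y Z : T -> Prop) :
  card_le nat J -> sigma_set op J Y -> sigma_set op J Z -> sigma_set op J (set_mul Y Z).
Proof.
  intros hJ [N hN] [M hM]. pose proof hJ as [c _].
  apply (sigma_set_of_index (I := (J * J)%type)); [exact (c 0, c 0)|now apply card_le_square|].
  exists (fun p => set_mul (N (fst p)) (M (snd p))).
  intros z [a [b [Ya [Zb ->]]]].
  destruct (hN a Ya) as [C [h1 [h2 [h3 h4]]]]. destruct (hM b Zb) as [D [k1 [k2 [k3 k4]]]].
  exists (set_mul C D). split; [now apply compact_mul|]. split; [now exists a, b|]. split.
  - intros x [u [v [h [k E]]]]. exists u, v. auto.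
  - intros O hO CDO.
    destruct (compact_mul_nbhd C D O) as [U [V [hU [hV [CU [DV UV]]]]]]; auto.
    destruct (h4 U hU CU) as [i [ia iU]]. destruct (k4 V hV DV) as [j [jb jV]].
    exists (i, j). split; [now exists a, b|].
    intros x [u [v [h [k E]]]]. apply UV. exists u, v. auto.
Qed.
End Product.

(* The compact set attached to [y] is the intersection of the [F n] containing [y]. *)
Lemma lindelof_sigma_compacts {Y : Type} (opY : (Y -> Prop) -> Prop) :
  lindelof_sigma opY ->
  exists (K : Type) (opK : (K -> Prop) -> Prop) (e : Y -> K) (F : nat -> K -> Prop),
    is_topology opK /\ compact opK /\ hausdorff opK /\ embedding opY opK e /\
    (forall n, closed opK (F n)) /\
    forall y z, (forall n, F n (e y) -> F n z) -> exists y', e y' = z.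
Proof.
  intros [K [opK [e [[h1 [h2 [h3 [h4 _]]]] [F [hF Fs]]]]]]. exists K, opK, e, F.
  repeat (split; [assumption|]). intros y z h. apply NNPP. intros n.
  destruct (Fs y z) as [k [a b]]; [|auto]. intros y' E. eauto.
Qed.

(** The network consists of the traces on [X] of finite intersections of the sets [F n], indexed by
    lists of natural numbers. The compact set of a point lies in [X] because the [F n] exclude the
    remainder. *)
Lemma sigma_set_of_lindelof_sigma {T J : Type} (op : (T -> Prop) -> Prop) (X : T -> Prop) :
  card_le nat J -> lindelof_sigma (subspace op X) -> sigma_set op J X.
Proof.
  intros hJ hX.
  destruct (lindelof_sigma_compacts _ hX) as [K [opK [e [F [Ht [Hc [Hh [[ei [ec eo]] [hF hC]]]]]]]]].
  apply (sigma_set_of_index (I := (list nat)%type)); [exact []|now apply card_le_list_inf|].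
  exists (fun l x => exists a : {x | X x}, proj1_sig a = x /\ forall n, In n l -> F n (e a)).
  intros x Xx. set (y := exist X x Xx : {x | X x}).
  set (D := fun z => forall n, F n (e y) -> F n z).
  assert (Dcl : closed opK D) by (apply closed_Inter; auto).
  assert (Dc : compact_set opK D).
  { apply compact_set_closed with (fun _ => True); auto. now apply compact_ind. }
  assert (lift : forall U, op U -> exists V, opK V /\
    forall a : {x | X x}, U (proj1_sig a) <-> V (e a)).
  { intros U hU. apply eo. exists U. split; [assumption|]. tauto. }
  exists (fun x => exists a : {x | X x}, proj1_sig a = x /\ D (e a)).
  split; [|split; [|split]].
  - intros P P0 Pm Pu H.
    apply (Dc (fun W => P (fun x => exists a : {x | X x}, proj1_sig a = x /\ W (e a)))).
    + apply Pm with (1 := P0). intros z [a [_ []]].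
    + intros A B PB AB. apply Pm with (1 := PB). intros z [a [h1 h2]]. eauto.
    + intros A B PA PB. apply Pm with (1 := Pu _ _ PA PB).
      intros z [a [h1 [h2|h2]]]; [left|right]; eauto.
    + intros z Dz. destruct (hC y z Dz) as [a <-].
      destruct (H (proj1_sig a)) as [U [hU [Ua PU]]]; [eauto|].
      destruct (lift U hU) as [V [hV EV]]. exists V. split; [assumption|].
      split; [now apply EV|]. apply Pm with (1 := PU).
      intros w [b [<- Vb]]. now apply EV.
  - exists y. split; [reflexivity|]. unfold D. auto.
  - intros z [[a Xa] [<- _]]. exact Xa.
  - intros U hU CU. destruct (lift U hU) as [V [hV EV]].
    (* Since [D] is the intersection of the [F n] containing [e y] and lies in the open set [V],
       compactness puts finitely many of these [F n] inside [V]. *)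
    destruct (compact_ind opK Hc (fun W => exists l, (forall n, In n l -> F n (e y)) /\
      forall z, W z -> (forall n, In n l -> F n z) -> V z)) as [l [ly lV]].
    + exists []. cbn. tauto.
    + intros A B [l [ly lV]] AB. exists l. auto.
    + intros A B [l [ly lV]] [l' [ly' lV']]. exists (l ++ l'). split.
      * intros n hn. apply in_app_iff in hn. destruct hn; auto.
      * intros z [h|h] hn; [apply lV|apply lV']; auto; intros n k; apply hn, in_app_iff; auto.
    + intros z _. destruct (classic (D z)) as [Dz|nD].
      * exists V. split; [assumption|]. split.
        -- destruct (hC y z Dz) as [a <-]. apply EV, CU. exists a. split; [reflexivity|exact Dz].
        -- exists []. split; [intros n []|auto].
      * apply not_all_ex_not in nD. destruct nD as [n hn]. apply imply_to_and in hn.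
        destruct hn as [ny nz]. exists (fun w => ~ F n w). split; [apply hF|].
        split; [assumption|]. exists [n]. split.
        -- intros m [<-|[]]. exact ny.
        -- intros w nw h. exfalso. apply nw, h. now left.
    + exists l. split; [now exists y|]. intros z [a [<- ha]]. apply EV. auto.
Qed.

(** A point is determined by the set of [n] with [F n (e y)], which is one of at most [2^omega]
    codes, and by its position in the compact set of that code, which Arhangel'skii's theorem bounds
    by [2^J]. *)
Theorem lindelof_sigma_card_le {Y J : Type} (opY : (Y -> Prop) -> Prop) :
  card_le nat J -> lindelof_sigma opY -> psi_le opY J -> card_le Y (J -> bool).
Proof.
  intros hJ hY Hpsi.
  destruct (lindelof_sigma_compacts _ hY) as [K [opK [e [F [Ht [Hc [Hh [[ei [ec eo]] [hF hC]]]]]]]]].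
  set (D := fun (b : nat -> bool) z => forall n, b n = true -> F n z).
  set (code := fun y n => if excluded_middle_informative (F n (e y)) then true else false).
  assert (codeP : forall y n, code y n = true <-> F n (e y)).
  { intros y n. unfold code. destruct (excluded_middle_informative _); split; congruence || tauto. }
  assert (H : forall b, (forall z, D b z -> exists y, e y = z) ->
    exists h : K -> J -> bool, forall z z', D b z -> D b z' -> h z = h z' -> z = z').
  { intros b hb.
    assert (Dcl : closed opK (D b)) by (apply closed_Inter; auto).
    destruct (compact_card_le_pow_psi (J := J) (subspace opK (D b))) as [h hi].
    - now apply subspace_topology.
    - apply subspace_compact. apply compact_set_closed with (fun _ => True); auto.
      now apply compact_ind.
    - now apply subspace_hausdorff.
    - assumption.
    (* All points of [D b] come from [Y], so a pseudobase at [y], extended to open sets of the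
       compactification, is a pseudobase at [z] within [D b]. *)
    - intros [z Dz]. destruct (hb z Dz) as [y Ey]. destruct (Hpsi y) as [S [P [hP Py]]].
      destruct (choice_on (fun _ : K => True) S (fun j V => opK V /\ forall a, P j a <-> V (e a)))
        as [V hV].
      { intros j Sj. apply eo, hP, Sj. }
      exists S, (fun j w => V j (proj1_sig w)). split.
      + intros j Sj. destruct (hV j Sj) as [h1 h2]. split.
        * exists (V j). tauto.
        * cbn. rewrite <- Ey. apply h2, hP, Sj.
      + intros [w Dw] hw. destruct (hb w Dw) as [y' Ey'].
        assert (E : y' = y).
        { apply Py. intros j Sj. apply (hV j Sj). rewrite Ey'. exact (hw j Sj). }
        subst. f_equal. apply proof_irrelevance.
    - exists (fun z => match excluded_middle_informative (D b z) with
        | left Dz => h (exist _ z Dz) | right _ => fun _ => true end).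
      intros z z' Dz Dz'.
      destruct (excluded_middle_informative (D b z)) as [q|]; [|contradiction].
      destruct (excluded_middle_informative (D b z')) as [q'|]; [|contradiction].
      intros E. apply hi in E. now injection E. }
  destruct (choice_on (fun _ _ => true) _ _ H) as [h hh].
  apply card_le_trans with ((nat -> bool) * (J -> bool))%type.
  - exists (fun y => (code y, h (code y) (e y))). intros y y' E. injection E as E1 E2.
    apply ei. apply (hh (code y)).
    + intros z Dz. apply (hC y). intros n hn. apply Dz. now apply codeP.
    + intros n hn. now apply codeP.
    + intros n hn. rewrite E1 in hn. now apply codeP.
    + now rewrite E2, E1.
  - apply card_le_trans with ((J -> bool) * (J -> bool))%type; [|now apply card_le_pow_square].
    apply card_le_prod; [|apply card_le_refl]. apply card_le_fun_l; [exact 0|assumption].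
Qed.

(** * Weight of a regular space with a small dense Sigma-subset *)

(** This says that [Y] has at most [2^J] points; values of [f] outside [Y] are allowed, so that no
    subset type is needed. *)
Definition pow_image {T : Type} (J : Type) (Y : T -> Prop) : Prop :=
  exists f : (J -> bool) -> T, forall y, Y y -> exists c, f c = y.

Section Weight.
Context {T J : Type} (op : (T -> Prop) -> Prop) (Ht : is_topology op).
Context (P : Type) (A B : P -> T -> Prop).

(* [s : list (list P)] encodes a finite union of finite intersections. *)
Definition inner (s : list (list P)) (x : T) : Prop :=
  exists l, In l s /\ forall p, In p l -> A p x.
(** A closed companion of [inner s] when the [B p] are open; it contains [inner s] whenever each
    [A p] is disjoint from [B p]. *)
Definition outer (s : list (list P)) (x : T) : Prop :=
  exists l, In l s /\ forall p, In p l -> ~ B p x.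

Lemma open_inner s : (forall p, op (A p)) -> op (inner s).
Proof.
  intros hA.
  apply (open_ext op (fun x => exists l : {l | In l s}, forall p, In p (proj1_sig l) -> A p x)).
  - apply open_Union; [assumption|]. intros l. now apply open_list_inter.
  - intros x. split.
    + intros [[l hl] h]. now exists l.
    + intros [l [hl h]]. now exists (exist _ l hl).
Qed.

Lemma open_not_outer s : (forall p, op (B p)) -> op (fun x => ~ outer s x).
Proof.
  intros hB. apply (open_ext op (fun x => forall l, In l s -> exists p : {p | In p l}, B (proj1_sig p) x)).
  - apply (open_list_inter op (fun l x => exists p : {p | In p l}, B (proj1_sig p) x)); [assumption|].
    intros l. apply open_Union; auto.
  - intros x. split.
    + intros h [l [hl k]]. destruct (h l hl) as [[p hp] Bp]. exact (k p hp Bp).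
    + intros h l hl. apply NNPP. intros n. apply h. exists l. split; [assumption|].
      intros p hp Bp. apply n. now exists (exist _ p hp).
Qed.

Lemma inner_outer s x : (forall p y, ~ (A p y /\ B p y)) -> inner s x -> outer s x.
Proof.
  intros d [l [hl h]]. exists l. split; [assumption|]. intros p hp Bp.
  apply (d p x). auto.
Qed.

(** Two nested compactness arguments: for fixed [y] in [Z], finitely many [B p] cover the part of
    [C] outside [O], and the matching [A p] intersect in a neighbourhood of [y]; finitely many of
    these cover the trace of [Z] on [C]. *)
Lemma separate_in_compact (C Z O : T -> Prop) :
  (forall p, op (A p)) -> (forall p, op (B p)) ->
  (forall x y, C x -> C y -> x <> y -> exists p, A p x /\ B p y) ->
  compact_set op C -> closed op Z -> op O -> (forall x, Z x -> O x) ->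
  exists s, (forall x, C x -> Z x -> inner s x) /\ (forall x, C x -> outer s x -> O x).
Proof.
  intros hA hB sep hC hZ hO ZO.
  destruct (hC (fun W => exists s, (forall x, W x -> C x -> Z x -> inner s x) /\
    forall x, C x -> outer s x -> O x)) as [s [h k]].
  - exists []. split; [tauto|]. intros x _ [l [[] _]].
  - intros W W' [s [h k]] WW. exists s. auto.
  - intros W W' [s [h k]] [s' [h' k']]. exists (s ++ s'). split.
    + intros x [w|w] Cx Zx; [destruct (h x w Cx Zx) as [l [a b]]|
        destruct (h' x w Cx Zx) as [l [a b]]]; exists l; rewrite in_app_iff; auto.
    + intros x Cx [l [hl hp]]. apply in_app_iff in hl.
      destruct hl; [apply k|apply k']; auto; exists l; auto.
  - intros y Cy. destruct (classic (Z y)) as [Zy|nZ].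
    + destruct (hC (fun W => exists l, (forall p, In p l -> A p y) /\
        forall x, W x -> C x -> (forall p, In p l -> ~ B p x) -> O x)) as [l [hl h]].
      * exists []. cbn. tauto.
      * intros W W' [l [hl h]] WW. exists l. split; auto.
      * intros W W' [l [hl h]] [l' [hl' h']]. exists (l ++ l'). split.
        -- intros p hp. apply in_app_iff in hp. destruct hp; auto.
        -- intros x [w|w] Cx k; [apply h|apply h']; auto; intros p hp; apply k, in_app_iff; auto.
      * intros x Cx. destruct (classic (O x)) as [Ox|nO].
        -- exists O. repeat split; auto. exists []. split; [intros p []|auto].
        -- destruct (sep y x) as [p [Ap Bp]]; auto.
           { intros ->. auto. }
           exists (B p). repeat split; auto. exists [p]. split.
           ++ intros q [<-|[]]. exact Ap.
           ++ intros z Bz _ k. exfalso. apply (k p); [now left|exact Bz].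
      * exists (fun x => forall p, In p l -> A p x).
        split; [now apply open_list_inter|]. split; [assumption|]. exists [l]. split.
        -- intros x hx _ _. exists l. split; [now left|exact hx].
        -- intros x Cx [l' [[<-|[]] k]]. auto.
    + exists (fun x => ~ Z x). split; [exact hZ|]. split; [assumption|].
      exists []. split; [tauto|]. intros x _ [l [[] _]].
  - exists s. auto.
Qed.
End Weight.

(** The base consists of the interiors of the closures of the sets [E c]. Regularity gives nested
    sets [W], [Z], [O], [Z1], [U] around [x]; a suitable [E c] contains the trace of [W] on [Y] and
    lies in [O], and density of [Y] puts [W] inside its closure. *)
Theorem weight_le_of_dense_sigma {T J : Type} (op : (T -> Prop) -> Prop) (Y : T -> Prop) :
  is_topology op -> hausdorff op -> regular op -> card_le nat J ->
  dense op Y -> sigma_set op J Y -> pow_image J Y -> weight_le op (J -> bool).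
Proof.
  intros Ht Hh Hr HJ Hd [N hN] [f hf].
  assert (HAB : forall p : (J -> bool) * (J -> bool), exists AB : (T -> Prop) * (T -> Prop),
    op (fst AB) /\ op (snd AB) /\ (forall y, ~ (fst AB y /\ snd AB y)) /\
    (f (fst p) <> f (snd p) -> fst AB (f (fst p)) /\ snd AB (f (snd p)))).
  { intros [c d]. destruct (classic (f c = f d)) as [E|n].
    - exists ((fun _ => False), (fun _ => False)). cbn.
      repeat split; try tauto; now apply open_empty.
    - destruct (Hh _ _ n) as [U [V h]]. exists (U, V). cbn. tauto. }
  destruct (choice_fun _ HAB) as [AB hAB]. clear HAB.
  set (A := fun p => fst (AB p)). set (B := fun p => snd (AB p)).
  assert (hA : forall p, op (A p)) by (intros; apply hAB).
  assert (hB : forall p, op (B p)) by (intros; apply hAB).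
  assert (dis : forall p y, ~ (A p y /\ B p y)) by (intros; apply hAB).
  assert (sep : forall x y, Y x -> Y y -> x <> y -> exists p, A p x /\ B p y).
  { intros x y Yx Yy n. destruct (hf x Yx) as [c <-]. destruct (hf y Yy) as [d <-].
    exists (c, d). now apply hAB. }
  set (E := fun (c : J -> list (list ((J -> bool) * (J -> bool)))) x =>
    exists j, N j x /\ inner _ A (c j) x).
  assert (HE : forall x U, op U -> U x -> exists c W, op W /\ W x /\
    (forall y, W y -> Y y -> E c y) /\
    exists Z, closed op Z /\ (forall y, E c y -> Z y) /\ forall y, Z y -> U y).
  { intros x U hU Ux.
    destruct (Hr x U hU Ux) as [O [Z1 [hO [hZ1 [Ox [OZ1 ZU]]]]]].
    destruct (Hr x O hO Ox) as [W [Z [hW [hZ [Wx [WZ ZO]]]]]].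
    set (good := fun j s => (forall y, N j y -> Z y -> inner _ A s y) /\
      forall y, N j y -> inner _ A s y -> O y).
    (* If no code is good for [j], the empty union is taken, which keeps [E c] inside [O]. *)
    destruct (choice_fun (fun j s => (forall y, N j y -> inner _ A s y -> O y) /\
      ((exists s', good j s') -> good j s))) as [c hc].
    { intros j. destruct (classic (exists s, good j s)) as [[s hs]|n].
      - exists s. split; [apply hs|auto].
      - exists []. split; [intros y _ [l [[] _]]|tauto]. }
    exists c, W. split; [assumption|]. split; [assumption|]. split.
    - intros y Wy Yy. destruct (hN y Yy) as [C [hC [Cy [CY hNC]]]].
      destruct (separate_in_compact op Ht _ A B C Z O) as [s [s1 s2]]; auto.
      (* This open set contains [C] by the choice of [s], and [s] is good for every network element
         contained in it, because [inner] lies in [outer]. *)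
      destruct (hNC (fun x => (inner _ A s x \/ ~ Z x) /\ (~ outer _ B s x \/ O x)))
        as [j [Njy hj]].
      + apply Ht; apply open_union; auto; [now apply open_inner|now apply open_not_outer].
      + intros z Cz. split.
        * destruct (classic (Z z)); auto.
        * destruct (classic (outer _ B s z)); auto.
      + assert (G : good j s).
        { split.
          - intros z Nz Zz. destruct (hj z Nz). tauto.
          - intros z Nz Iz. destruct (hj z Nz) as [_ [h|h]]; [|assumption].
            exfalso. apply h. now apply (inner_outer _ A B). }
        exists j. split; [assumption|]. destruct (hc j) as [_ h].
        apply h; eauto.
    - exists Z1. split; [assumption|]. split; [|assumption].
      intros y [j [Ny Iy]]. apply OZ1. exact (proj1 (hc j) y Ny Iy). }
  destruct (card_le_surj (fun _ => []) (card_le_fun_list_pow J HJ)) as [g hg].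
  (* The set indexed by [k] is the interior of the closure of [E (g k)]. *)
  exists (fun _ => True), (fun k x => exists W, op W /\ W x /\
    forall w V, W w -> op V -> V w -> exists y, E (g k) y /\ V y).
  split.
  - intros k _. apply open_local; [assumption|]. intros x [W [hW [Wx h]]].
    exists W. repeat split; auto. intros y Wy. exists W. auto.
  - intros U x hU Ux. destruct (HE x U hU Ux) as [c [W [hW [Wx [WE [Z [hZ [EZ ZU]]]]]]]].
    destruct (hg c) as [k <-]. exists k. split; [exact I|]. split.
    + exists W. repeat split; auto. intros w V Ww hV Vw.
      destruct (Hd (fun y => W y /\ V y)) as [y [[Wy Vy] Yy]].
      * now apply Ht.
      * eauto.
      * exists y. auto.
    + intros y [W' [hW' [Wy h]]]. apply ZU. apply NNPP. intros n.
      destruct (h y (fun z => ~ Z z) Wy hZ n) as [z [Ez nz]]. auto.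
Qed.

(** * Topological groups *)

(** The group axioms are one-sided, so right inverses are derived from [inv (inv x)]. *)
Lemma topgroup_mulV {G : Type} (mul : G -> G -> G) (inv : G -> G) (e : G) :
  (forall x y z, mul x (mul y z) = mul (mul x y) z) ->
  (forall x, mul e x = x) -> (forall x, mul (inv x) x = e) -> forall x, mul x (inv x) = e.
Proof.
  intros Ha H1 HV x. rewrite <- (H1 (mul x (inv x))), <- (HV (inv x)).
  rewrite <- (Ha (inv (inv x)) (inv x)). f_equal.
  rewrite (Ha (inv x)), HV. apply H1.
Qed.

(** If the product of [V] and a neighbourhood [W] of [e] lies in [U], so does the closure of [V]: a
    point [z] of it equals [v (v^{-1} z)] for some [v] in [V] with [v^{-1} z] in [W]. *)
Lemma topgroup_regular {G : Type} (op : (G -> Prop) -> Prop) (mul : G -> G -> G)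
  (inv : G -> G) (e : G) : is_topgroup op mul inv e -> regular op.
Proof.
  intros [Ht [Ha [H1 [HV [Hm Hi]]]]] x U hU Ux.
  pose proof (topgroup_mulV mul inv e Ha H1 HV) as HV'.
  destruct (Hm U x e hU) as [V [W [hV [hW [Vx [We VW]]]]]].
  { replace (mul x e) with x; [assumption|]. now rewrite <- (HV x), Ha, HV', H1. }
  exists V, (fun z => forall O, op O -> O z -> exists y, O y /\ V y).
  split; [assumption|]. split; [|split; [assumption|split; [eauto|]]].
  - apply (open_local op); [assumption|]. intros z nz.
    apply not_all_ex_not in nz. destruct nz as [O nO].
    apply imply_to_and in nO. destruct nO as [hO nO]. apply imply_to_and in nO.
    destruct nO as [Oz nO]. exists O. split; [assumption|]. split; [assumption|].
    intros y Oy h. apply nO. exact (h O hO Oy).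
  - intros z hz. destruct (hz (fun v => W (mul (inv v) z))) as [v [Wv Vv]].
    + apply open_local; [assumption|]. intros v hv.
      destruct (Hm W (inv v) z hW hv) as [A [B [hA [hB [Av [Bz AB]]]]]].
      exists (fun u => A (inv u)). split; [now apply Hi|]. split; auto.
    + now rewrite HV.
    + replace z with (mul v (mul (inv v) z)); [auto|]. now rewrite Ha, HV', H1.
Qed.

(* [words n] exhausts a superset of the subgroup generated by [X]; no inverse
   laws are needed since inverses are added at every stage. *)
Fixpoint words {G : Type} (mul : G -> G -> G) (inv : G -> G) (e : G) (X : G -> Prop) (n : nat)
  : G -> Prop :=
  match n with
  | 0 => fun x => X x \/ x = e
  | S n => let W := words mul inv e X n in
    fun x => W x \/ (set_mul mul W W x \/ exists y, W y /\ x = inv y)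
  end.

(** The stages increase, so two elements share a stage and their product appears at the next one;
    the union of the stages is thus closed under the operations. *)
Lemma gen_subgroup_words {G : Type} (mul : G -> G -> G) (inv : G -> G) (e : G) (X : G -> Prop) x :
  gen_subgroup mul inv e X x -> exists n, words mul inv e X n x.
Proof.
  assert (mono : forall m n x, m <= n -> words mul inv e X m x -> words mul inv e X n x).
  { intros m n y h. induction h; [auto|]. cbn. auto. }
  intros h. apply h.
  - exists 0. cbn. auto.
  - intros a b [m hm] [n hn]. exists (S (max m n)). cbn. right. left. exists a, b.
    repeat split; [apply (mono m)|apply (mono n)]; auto; lia.
  - intros a [n hn]. exists (S n). cbn. eauto.
  - intros y Xy. exists 0. cbn. auto.
Qed.

(** * Closure properties of sets with at most [2^J] points *)

Section Small.
Context {J G : Type} (HJ : card_le nat J).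

Lemma pow_image_binary (h : G -> G -> G) (Y Z : G -> Prop) :
  pow_image J Y -> pow_image J Z -> pow_image J (fun x => exists y z, Y y /\ Z z /\ x = h y z).
Proof.
  intros [f hf] [g hg].
  destruct (card_le_surj ((fun _ => true), (fun _ => true)) (card_le_pow_square J HJ)) as [k hk].
  exists (fun c => h (f (fst (k c))) (g (snd (k c)))).
  intros x [y [z [Yy [Zz ->]]]]. destruct (hf y Yy) as [a <-]. destruct (hg z Zz) as [b <-].
  destruct (hk (a, b)) as [c Ec]. exists c. now rewrite Ec.
Qed.

Lemma pow_image_Union (Y : nat -> G -> Prop) :
  (forall n, pow_image J (Y n)) -> pow_image J (fun x => exists n, Y n x).
Proof.
  intros H. destruct (choice_fun _ H) as [f hf].
  assert (K : card_le (nat * (J -> bool)) (J -> bool)).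
  { apply card_le_trans with ((J -> bool) * (J -> bool))%type; [|now apply card_le_pow_square].
    apply card_le_prod; [now apply nat_le_pow|apply card_le_refl]. }
  destruct (card_le_surj (0, fun _ => true) K) as [k hk].
  exists (fun c => f (fst (k c)) (snd (k c))).
  intros x [n Yx]. destruct (hf n x Yx) as [a <-]. destruct (hk (n, a)) as [c Ec].
  exists c. now rewrite Ec.
Qed.

Lemma pow_image_union (Y Z : G -> Prop) :
  pow_image J Y -> pow_image J Z -> pow_image J (fun x => Y x \/ Z x).
Proof.
  intros hY hZ. destruct (pow_image_Union (fun n => match n with 0 => Y | S _ => Z end))
    as [f hf]; [intros [|n]; assumption|].
  exists f. intros x [h|h]; apply hf; [now exists 0|now exists 1].
Qed.
End Small.

(** * Weights of a group and of a Lindelöf Sigma-subspace generating it densely *)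

Theorem mainTheorem8 (G : Type) (op : (G -> Prop) -> Prop)
  (mul : G -> G -> G) (inv : G -> G) (e : G)
  (HG : is_topgroup op mul inv e) (HH : hausdorff op)
  (X : G -> Prop)
  (HX : lindelof_sigma (subspace op X))
  (Hdense : dense op (gen_subgroup mul inv e X)) :
  (* w(X) <= w(H)   (weights taken with infinite values) *)
  (forall I : Type, weight_le op I -> weight_le (subspace op X) (I + nat)) /\
  (* w(H) <= 2^psi(X): for every infinite kappa >= psi(X), w(H) <= 2^kappa *)
  (forall J : Type, card_le nat J -> psi_le (subspace op X) J ->
     weight_le op (J -> bool)).
Proof.
  split.
  (* The traces on [X] of a base keep their indices in the left summand; the summand [nat] makes the
     index type infinite. *)
  - intros I [S [B [hB h]]].
    exists (fun i => match i with inl i => S i | inr _ => False end),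
      (fun i x => match i with inl i => B i (proj1_sig x) | inr _ => False end).
    split.
    + intros [i|n] hi; [|contradiction]. exists (B i). split; [auto|tauto].
    + intros U x [V [hV EV]] Ux. apply EV in Ux.
      destruct (h V (proj1_sig x) hV Ux) as [i [Si [Bi BV]]]. exists (inl i).
      repeat split; auto. intros y By. apply EV. auto.
  - intros J HJ Hpsi. pose proof HG as [Ht [Ha [H1 [HV [Hm Hi]]]]].
    pose proof HJ as [c0 _].
    (* The dense set is the union of all stages [words n]; its Sigma-property and its size are both
       obtained by induction on the stage. *)
    apply (weight_le_of_dense_sigma op (fun x => exists n, words mul inv e X n x)); auto.
    + now apply (topgroup_regular op mul inv e).
    + intros U hU Une. destruct (Hdense U hU Une) as [x [Ux gx]]. exists x.
      split; [assumption|]. now apply gen_subgroup_words.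
    + apply sigma_set_Union; [assumption|]. intros n. induction n as [|n IH].
      * apply sigma_set_union; [assumption| |exact (sigma_set_single op (c0 0) e)].
        now apply sigma_set_of_lindelof_sigma.
      * apply sigma_set_union; [assumption|assumption|].
        apply sigma_set_union; [assumption| |].
        -- now apply sigma_set_mul.
        -- now apply sigma_set_image.
    + apply pow_image_Union; [assumption|]. intros n. induction n as [|n IH].
      * apply pow_image_union; [assumption| |exists (fun _ => e); intros y ->; exists (fun _ => true); reflexivity].
        destruct (lindelof_sigma_card_le _ HJ HX Hpsi) as [f fi].
        (* The injection of [X] into [2^J] is inverted on its range, with the value [e] as
           default. *)
        destruct (choice_on e (fun c => exists x, f x = c)
          (fun c y => forall x, f x = c -> proj1_sig x = y)) as [g hg].
        { intros c [x hx]. exists (proj1_sig x). intros x' hx'. f_equal. apply fi. congruence. }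
        exists g. intros y Xy. exists (f (exist _ y Xy)). symmetry.
        apply (hg (f (exist _ y Xy)) (ex_intro _ _ eq_refl) (exist X y Xy) eq_refl).
      * apply pow_image_union; [assumption|assumption|].
        apply pow_image_union; [assumption| |].
        -- now apply pow_image_binary.
        -- destruct IH as [f hf]. exists (fun c => inv (f c)).
           intros x [y [hy ->]]. destruct (hf y hy) as [c <-]. now exists c.
Qed.
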